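(* For any $R>0$, there exist infinitely many real-analytic plurisubharmonic solutions $u$ to $\det(\partial\bar\partial u)=1$ on $\mathbb{C}\times D_R$ such that the corresponding Kähler metric $\partial\bar\partial u$ is nowhere flat on $\mathbb{C}\times D_R$.
   Context: Coordinates on $\mathbb{C}^2$ are $(z,w)$; $D_R=\{w\in\mathbb{C}:|w|<R\}$. For a real-valued function $u$ on an open subset of $\mathbb{C}^2$, $\partial\bar\partial u$ denotes its complex Hessian, the $2\times 2$ matrix $\begin{bmatrix} u_{\bar z z} & u_{z\bar w}\\ u_{\bar z w} & u_{\bar w w}\end{bmatrix}$. A plurisubharmonic solution of $\det(\partial\bar\partial u)=1$ has positive definite complex Hessian, so $g_{\alpha\bar\beta}=(\partial\bar\partial u)_{\alpha\bar\beta}$ defines a Kähler metric. The metric is nowhere flat if its curvature tensor is nonzero at every point. *)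

(* Defs.v *)
From HB Require Import structures.
From mathcomp Require Import all_boot all_order all_algebra.
From mathcomp Require Import complex.
From mathcomp Require Import all_classical all_reals all_analysis.

Set Implicit Arguments.
Unset Strict Implicit.
Unset Printing Implicit Defensive.

Import Order.TTheory GRing.Theory Num.Theory.
Import numFieldNormedType.Exports.

Local Open Scope classical_set_scope.
Local Open Scope complex_scope.
Local Open Scope ring_scope.

(* C^n is 'rV[R[i]]_n; on C^2 the coordinates are (z, w) = (p 0 0, p 0 1). *)

Section RealAnalytic.
Variable R : realType.

Definition monomial (m : nat) (k : {ffun 'I_m -> nat}) (h : 'rV[R]_m) : R :=
  \prod_(j < m) h 0 j ^+ k j.

(* The power series converges absolutely on a neighbourhood of the centre, so
   its sum is the limit of the partial sums over the cubes {0, .., N-1}^m. *)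
Definition real_analytic_at (m : nat) (f : 'rV[R]_m -> R) (x : 'rV[R]_m) :=
  exists (c : {ffun 'I_m -> nat} -> R) (e : R), 0 < e /\
    forall h : 'rV[R]_m, (forall j, `|h 0 j| < e) ->
      summable [set: {ffun 'I_m -> nat}] (fun k => (c k * monomial k h)%:E) /\
      (\sum_(k : {ffun 'I_m -> 'I_N})
          c [ffun j => val (k j)] * monomial [ffun j => val (k j)] h)
        @[N --> \oo] --> f (x + h).

Definition complex_of_coords (n : nat) (x : 'rV[R]_(n + n)) : 'rV[R[i]]_n :=
  \row_j (x 0 (lshift n j) +i* x 0 (rshift n j)).

Definition real_analytic_on (n : nat) (Om : set 'rV[R[i]]_n)
    (u : 'rV[R[i]]_n -> R) :=
  forall x : 'rV[R]_(n + n), Om (complex_of_coords x) ->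
    real_analytic_at (u \o @complex_of_coords n) x.

End RealAnalytic.

Section Plurisubharmonic.
Variables (R : realType) (n : nat).

(* Om is meant to be open. Upper semicontinuity, and the sub-mean value inequality on the
   boundary of every closed complex disc contained in Om. The integral is
   extended-real valued since that of a semicontinuous u may be -oo. *)
Definition plurisubharmonic_on (Om : set 'rV[R[i]]_n) (u : 'rV[R[i]]_n -> R) :=
  (forall p, Om p -> forall a : R, u p < a -> exists e : R, 0 < e /\
    forall q, Om q -> (forall j, `|q 0 j - p 0 j| < e%:C) -> u q < a) /\
  (forall p v : 'rV[R[i]]_n,
    (forall zeta : R[i], `|zeta| <= 1 -> Om (p + zeta *: v)) ->
    ((u p)%:E <= ((2 * pi)^-1)%:E *
      \int[lebesgue_measure]_(t in `[0%R, (2 * pi)%R])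
        (u (p + (cos t +i* sin t)%C *: v)%R)%:E)%E).

End Plurisubharmonic.

Section KahlerGeometry.
Variables (R : realType) (n : nat).
Implicit Types (f : 'rV[R[i]]_n -> R[i]) (p v : 'rV[R[i]]_n).

(* Derivative at p of f along the real line through p with direction v. *)
Definition dir_derive f p v : R[i] :=
  derive1 (fun t : R => complex.Re (f (p + t%:C *: v))) 0
    +i* derive1 (fun t : R => complex.Im (f (p + t%:C *: v))) 0.

Definition dz (a : 'I_n) f p : R[i] :=
  2^-1 * (dir_derive f p (delta_mx 0 a)
          - 'i%C * dir_derive f p ('i%C *: delta_mx 0 a)).

Definition dzbar (a : 'I_n) f p : R[i] :=
  2^-1 * (dir_derive f p (delta_mx 0 a)
          + 'i%C * dir_derive f p ('i%C *: delta_mx 0 a)).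

Definition complex_hessian (u : 'rV[R[i]]_n -> R) p : 'M[R[i]]_n :=
  \matrix_(a, b) dz a (dzbar b (fun q => (u q)%:C)) p.

(* R_{a bbar c dbar} = - d_c d_dbar g_{a bbar}
                       + g^{l mbar} (d_c g_{a mbar}) (d_dbar g_{l bbar}),
   where (g^{l mbar}) is, in position (m, l), the inverse matrix of g. *)
Definition kahler_curvature (g : 'rV[R[i]]_n -> 'M[R[i]]_n) p
    (a b c d : 'I_n) : R[i] :=
  - dz c (dzbar d (fun q => g q a b)) p
  + \sum_(l < n) \sum_(m < n) invmx (g p) m l
      * dz c (fun q => g q a m) p * dzbar d (fun q => g q l b) p.

Definition nowhere_flat_on (Om : set 'rV[R[i]]_n)
    (g : 'rV[R[i]]_n -> 'M[R[i]]_n) :=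
  forall p, Om p -> exists a b c d, kahler_curvature g p a b c d != 0.

End KahlerGeometry.

(* C x D_r *)
Definition cylinder (R : realType) (r : R) : set 'rV[R[i]]_2 :=
  [set p | `|p 0 1| < r%:C].

(* Main.v *)
Require Import Defs.
From mathcomp Require Import all_boot all_order all_algebra.
From mathcomp Require Import complex.
From mathcomp Require Import all_classical all_reals all_analysis.
From mathcomp Require Import ring lra.
Import Order.TTheory GRing.Theory Num.Theory.
Import numFieldNormedType.Exports.
Local Open Scope classical_set_scope.
Local Open Scope complex_scope.
Local Open Scope ring_scope.

Set Implicit Arguments.
Unset Strict Implicit.
Unset Printing Implicit Defensive.

(** For k > 0 put x = Re z, t = k + Re w, and consider
      u_k (z, w) = x^2 / t + (4 / 3) t^3
    where t > 0.  Since u_k depends on the real parts alone, its complex Hessian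
    is a quarter of its real Hessian in (x, t), whose determinant is
      (2 / t) (2 x^2 / t^3 + 8 t) - (2 x / t^2)^2 = 16:
    the quadratic dependence on x makes the terms in x^2 cancel, because the
    reciprocal t of the coefficient of x^2 is harmonic in w, and the cubic term
    is there to supply the constant.  A positive harmonic function on the whole
    plane is constant, so u_k cannot be extended to all of C^2, but t is
    positive on D_r as soon as k >= r.

    The summand x^2 / t is the perspective of a square, so u_k is convex where
    t > 0, and a convex function of the real parts is plurisubharmonic: on a
    circle, a supporting affine function averages to its value at the centre
    (plurisubharmonic_tube).  The metric is
      g_00 = 1 / (2 t),   g_01 = g_10 = - x / (2 t^2),
      g_11 = x^2 / (2 t^3) + 2 t,
    and as g_00 does not depend on x, the only surviving term of R_0000 is
    g^11 |d_0 g_01|^2 = 1 / (32 t^5), which never vanishes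
    (curvature_potential).
    Real-analyticity reduces to one variable: u_k is a sum of two products of
    functions of single coordinates, each a polynomial or an inverse
    (real_analytic_at_prod, real_analytic_atD).

    The values k = r + n, for n a natural number, give infinitely many
    solutions, told apart by their values (4 / 3) k^3 at the origin. *)

(** * Power series in several variables *)

(** Absolute convergence of the series is expressed by a bound on the partial
    sums of its absolute values, the form that multiplies well. *)
Definition analytic1_at (R : realType) (f : R -> R) (x : R) :=
  exists (a : nat -> R) (e : R), 0 < e /\ forall h, `|h| < e ->
    (exists M : R, forall N, \sum_(i < N) `|a i * h ^+ i| <= M) /\
    (\sum_(i < N) a i * h ^+ i) @[N --> \oo] --> f (x + h).

(** Every finite set of multi-indices lies in a cube, so bounds on the sums over
    cubes suffice. *)
Lemma summable_multiindex (R : realType) (m : nat)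
    (F : {ffun 'I_m -> nat} -> R) (M : R) :
  (forall N, \sum_(k : {ffun 'I_m -> 'I_N}) `|F [ffun j => val (k j)]| <= M) ->
  summable [set: {ffun 'I_m -> nat}] (fun k => (F k)%:E).
Proof.
move=> FM; rewrite /summable; apply: (@le_lt_trans _ _ M%:E); last exact: ltry.
apply: ge_ereal_sup => _ [A [finA _]] <-.
rewrite fsbig_finite//= sumEFin lee_fin.
pose s := finmap.enum_fset (fset_set A); rewrite -/s.
pose N := (\max_(k <- s) \max_j k j).+1.
pose nat_of (k : {ffun 'I_m -> 'I_N}) := [ffun j => val (k j)].
have nat_of_inj : injective nat_of.
  move=> k l /ffunP kl; apply/ffunP => j; apply: val_inj.
  by have := kl j; rewrite !ffunE.
apply: le_trans (FM N); rewrite -(big_map nat_of xpredT (fun k => `|F k|)).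
set t := map _ _; have ut : uniq t by rewrite map_inj_uniq// index_enum_uniq.
have us : uniq s by exact: finmap.fset_uniq.
have st : {subset s <= t}.
  move=> k ks; apply/mapP; exists [ffun j => inord (k j)].
    by rewrite mem_index_enum.
  apply/ffunP => j; rewrite !ffunE /= inordK// ltnS.
  by apply: leq_trans (leq_bigmax_seq k ks _) => //; exact: leq_bigmax.
rewrite [leRHS](bigID (mem s))/= -[leRHS]/(_ + _) -[leLHS]addr0
  lerD ?sumr_ge0//.
rewrite -[leRHS]big_filter le_eqVlt; apply/orP; left; apply/eqP/perm_big.
apply: uniq_perm => //; first exact: filter_uniq.
by move=> k; rewrite mem_filter; case ks : (k \in s) => //=; rewrite st.
Qed.

(** A sum over a cube of a product of one-variable terms is the product of the
    one-variable partial sums, so both bounds and limits pass from the factors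
    to the product, with no Cauchy product of series. *)
Lemma real_analytic_at_prod (R : realType) (m : nat) (f : 'I_m -> R -> R)
    (x : 'rV[R]_m) :
  (forall j, analytic1_at (f j) (x 0 j)) ->
  real_analytic_at (fun y => \prod_j f j (y 0 j)) x.
Proof.
move=> /choice[a] /choice[e] ae.
exists (fun k => \prod_j a j (k j)), (\big[Num.min/1]_j e j); split.
  by apply: lt_bigmin => // j _; case: (ae j).
move=> h he.
have {}he j : `|h 0 j| < e j.
  by apply: lt_le_trans (he j) _; exact: bigmin_le.
have {}ae j := (ae j).2 _ (he j).
have /choice[M aM] j := (ae j).1.
have monoE (k : {ffun 'I_m -> nat}) :
    (\prod_j a j (k j)) * monomial k h = \prod_j (a j (k j) * h 0 j ^+ k j).
  by rewrite big_split.
split.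
  apply: (@summable_multiindex _ _ _ (\prod_j M j)) => N.
  rewrite (eq_bigr (fun k : {ffun 'I_m -> 'I_N} =>
    \prod_j `|a j (k j) * h 0 j ^+ k j|)); last first.
    move=> k _; rewrite monoE normr_prod.
    by apply: eq_bigr => j _; rewrite ffunE.
  rewrite -(bigA_distr_bigA (fun j (i : 'I_N) => `|a j i * h 0 j ^+ i|)).
  by apply: ler_prod => j _; rewrite aM sumr_ge0.
under eq_cvg => N.
  rewrite (eq_bigr (fun k : {ffun 'I_m -> 'I_N} =>
    \prod_j (a j (k j) * h 0 j ^+ k j))); last first.
    by move=> k _; rewrite monoE; apply: eq_bigr => j _; rewrite ffunE.
  rewrite -(bigA_distr_bigA (fun j (i : 'I_N) => a j i * h 0 j ^+ i)).
  over.
apply: cvg_big => [|j _].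
  by move=> p; exact: mul_continuous.
by rewrite mxE; exact: (ae j).2.
Qed.

Lemma real_analytic_atD (R : realType) (m : nat) (f g : 'rV[R]_m -> R)
    (x : 'rV[R]_m) :
  real_analytic_at f x -> real_analytic_at g x ->
  real_analytic_at (fun y => f y + g y) x.
Proof.
move=> [a [d [d0 fa]]] [b [e [e0 gb]]].
exists (fun k => a k + b k), (Num.min d e); split; first by rewrite lt_min d0.
move=> h hde.
have [] := fa h; first by move=> j; have := hde j; rewrite lt_min => /andP[].
move=> fs fc.
have [] := gb h; first by move=> j; have := hde j; rewrite lt_min => /andP[].
move=> gs gc; split.
  rewrite (_ : (fun k => _) = (fun k => (a k * monomial k h)%:E)
      \+ (fun k => (b k * monomial k h)%:E))%E; first exact: summableD.
  by apply/funext => k; rewrite mulrDl EFinD.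
under eq_cvg => N.
  under eq_bigr => k _ do rewrite mulrDl.
  rewrite big_split/=.
  over.
exact: cvgD.
Qed.

Lemma analytic1_poly (R : realType) (p : {poly R}) (x : R) :
  analytic1_at (horner p) x.
Proof.
pose q := p \Po ('X + x%:P); exists (fun i => q`_i), 1; split => // h _.
have sumE (F : nat -> R) N : (forall i, q`_i = 0 -> F i = 0) ->
    (size q <= N)%N -> \sum_(i < N) F i = \sum_(i < size q) F i.
  move=> F0 qN; rewrite -(subnKC qN) big_split_ord/= [X in _ + X]big1 ?addr0//.
  by move=> i _; rewrite F0// nth_default// leq_addr.
split.
  exists (\sum_(i < size q) `|q`_i * h ^+ i|) => N.
  rewrite -(sumE (fun i => `|q`_i * h ^+ i|) (maxn N (size q)))//.
  - rewrite -(subnKC (leq_maxl N (size q))) big_split_ord/= lerDl.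
    exact: sumr_ge0.
  - by move=> i ->; rewrite mul0r normr0.
  - exact: leq_maxr.
have -> : p.[x + h] = \sum_(i < size q) q`_i * h ^+ i.
  by rewrite -horner_coef horner_comp !hornerE addrC.
apply: cvg_near_cst; exists (size q) => // N/= qN.
by apply: (sumE (fun i => q`_i * h ^+ i)) => // i ->; rewrite mul0r.
Qed.

(** The geometric series of ratio - h / x, which converges for |h| < |x|. *)
Lemma analytic1_inv (R : realType) (x : R) : x != 0 -> analytic1_at GRing.inv x.
Proof.
move=> x0; exists (fun i => x^-1 * (- x^-1) ^+ i), `|x|; split.
  by rewrite normr_gt0.
move=> h hx; pose z := - x^-1 * h.
have z1 : `|z| < 1.
  by rewrite normrM normrN normfV mulrC ltr_pdivrMr ?normr_gt0 ?mul1r.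
have termE i : x^-1 * (- x^-1) ^+ i * h ^+ i = geometric x^-1 z i.
  by rewrite /geometric /= /z exprMn mulrA.
split.
  exists (`|x^-1| / (1 - `|z|)) => N.
  under eq_bigr => i _ do rewrite termE normrM normrX.
  rewrite -(big_mkord xpredT (fun i => `|x^-1| * `|z| ^+ i)).
  rewrite -[leLHS]/(series (geometric `|x^-1| `|z|) N).
  rewrite geometric_seriesE ?lt_eqF//= ler_pM2r ?invr_gt0 ?subr_gt0//.
  by rewrite ler_piMr// gerBl exprn_ge0.
under eq_cvg => N.
  under eq_bigr => i _ do rewrite termE.
  rewrite -(big_mkord xpredT (geometric x^-1 z)).
  over.
have -> : (x + h)^-1 = x^-1 / (1 - z).
  by rewrite -invfM mulrBr mulr1 /z mulNr mulrN opprK mulrA divff// mul1r.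
exact: cvg_geometric_series.
Qed.

Lemma analytic1_shift (R : realType) (f : R -> R) (k x : R) :
  analytic1_at f (k + x) -> analytic1_at (fun t => f (k + t)) x.
Proof.
move=> [a [e [e0 fa]]]; exists a, e; split => // h /fa[aM].
by rewrite -addrA.
Qed.

(** * Complex derivatives of functions of the real parts *)

Definition re_part (R : realType) (n : nat) (p : 'rV[R[i]]_n) : 'rV[R]_n :=
  map_mx (@complex.Re R) p.

(** The name refers to tube domains, those invariant under imaginary
    translations. *)
Definition tube (R : realType) (n : nat) (F : 'rV[R]_n -> R) :=
  fun p : 'rV[R[i]]_n => (F (re_part p))%:C.

Definition half_partial (R : realType) (n : nat) (a : 'I_n)
    (F : 'rV[R]_n -> R) (x : 'rV[R]_n) : R :=
  2^-1 * 'D_(delta_mx 0 a) F x.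

Lemma re_partDZ (R : realType) (n : nat) (p v : 'rV[R[i]]_n) (t : R) :
  re_part (p + t%:C *: v) = re_part p + t *: re_part v.
Proof.
apply/rowP => j; rewrite !mxE; case: (p 0 j) (v 0 j) => a b [c d] /=.
by rewrite mul0r subr0.
Qed.

Lemma dir_derive_tube (R : realType) (n : nat) (F : 'rV[R]_n -> R)
    (p v : 'rV[R[i]]_n) :
  dir_derive (tube F) p v = ('D_(re_part v) F (re_part p))%:C.
Proof.
rewrite /dir_derive /= (derive1_cst (0 : R)); congr (_ +i* _)%C.
rewrite /derive1 /derive.
set d := (fun h : R => _); set d' := (fun h : R => _).
suff -> : d = d' by [].
apply/funext => h; rewrite /d /d' /= !re_partDZ.
by rewrite addr0 scale0r addr0 (addrC (re_part p)).
Qed.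

Lemma re_part_delta (R : realType) (n : nat) (a : 'I_n) :
  re_part (delta_mx 0 a : 'rV[R[i]]_n) = delta_mx 0 a.
Proof. by apply/rowP => j; rewrite !mxE; case: (_ && _). Qed.

Lemma re_part_idelta (R : realType) (n : nat) (a : 'I_n) :
  re_part ('i%C *: delta_mx 0 a : 'rV[R[i]]_n) = 0.
Proof.
by apply/rowP => j; rewrite !mxE; case: (_ && _); rewrite ?mulr1 ?mulr0.
Qed.

(** The imaginary directions contribute nothing, so both Wirtinger derivatives
    are half the real partial derivative.  No differentiability is assumed,
    hence the equality is one of functions and can be iterated. *)
Lemma dz_tube (R : realType) (n : nat) (a : 'I_n) (F : 'rV[R]_n -> R) :
  dz a (tube F) = tube (half_partial a F).
Proof.
apply/funext => p; rewrite /dz !dir_derive_tube re_part_delta re_part_idelta.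
rewrite derive0 mulr0 subr0 /tube /half_partial.
by rewrite rmorphM fmorphV rmorph_nat.
Qed.

Lemma dzbar_tube (R : realType) (n : nat) (a : 'I_n) (F : 'rV[R]_n -> R) :
  dzbar a (tube F) = tube (half_partial a F).
Proof.
apply/funext => p; rewrite /dzbar !dir_derive_tube re_part_delta re_part_idelta.
rewrite derive0 mulr0 addr0 /tube /half_partial.
by rewrite rmorphM fmorphV rmorph_nat.
Qed.

Lemma complex_hessian_tube (R : realType) (n : nat) (F : 'rV[R]_n -> R) p :
  complex_hessian (F \o @re_part R n) p =
  \matrix_(a, b) tube (half_partial a (half_partial b F)) p.
Proof.
apply/matrixP => a b; rewrite !mxE.
by rewrite (dzbar_tube b F) dz_tube.
Qed.

(** A derivative only depends on the germ, so a closed form valid on an open set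
    can be differentiated there. *)
Lemma half_partial_open (R : realType) (n : nat) (a : 'I_n)
    (A : set 'rV[R]_n) (F G : 'rV[R]_n -> R) (x : 'rV[R]_n) (d : R) :
  open A -> A x -> (forall y, A y -> F y = G y) ->
  is_derive x (delta_mx 0 a) G (2 * d) ->
  half_partial a F x = d.
Proof.
move=> oA Ax FG dG; rewrite /half_partial (@near_eq_derive _ _ _ _ G).
  by rewrite derive_val mulKf.
exact: filterS FG (open_nbhs_nbhs (conj oA Ax)).
Qed.

Lemma is_derive_coord (R : realType) (n : nat) (x v : 'rV[R]_n) (j : 'I_n) :
  is_derive x v (fun y : 'rV[R]_n => y 0 j) (v 0 j).
Proof.
suff cv : (fun h : R => h^-1 *: ((fun y : 'rV[R]_n => y 0 j) (h *: v + x)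
    - x 0 j)) h @[h --> 0^'] --> v 0 j.
  by split; [exact: cvgP cv | exact: cvg_lim cv].
apply: cvg_near_cst; near=> h.
rewrite !mxE addrK [LHS]mulKf//.
by near: h; exact: nbhs_dnbhs_neq.
Unshelve. all: by end_near. Qed.

(** * The metric and its curvature *)

Lemma big2E (T : Type) (idx : T) (op : Monoid.law idx) (F : 'I_2 -> T) :
  \big[op/idx]_i F i = op (F 0) (F 1).
Proof.
rewrite !big_ord_recl big_ord0 Monoid.mulm1.
by congr (op _ (F _)); apply: val_inj.
Qed.

Lemma det2E (R : comPzRingType) (A : 'M[R]_2) :
  \det A = A 0 0 * A 1 1 - A 0 1 * A 1 0.
Proof.
have l1 : lift ord0 ord0 = 1 :> 'I_2 by apply: val_inj.
have l0 : lift 1 0 = 0 :> 'I_2 by apply: val_inj.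
rewrite (expand_det_row _ 0) !big_ord_recl big_ord0 addr0 /cofactor !det_mx11.
by rewrite !mxE !l1 l0 /= addn0 expr0 mul1r expr1 mulN1r mulrN.
Qed.

Lemma invmx2_11 (R : comUnitRingType) (A : 'M[R]_2) :
  \det A = 1 -> invmx A 1 1 = A 0 0.
Proof.
move=> A1; have l0 : lift 1 0 = 0 :> 'I_2 by apply: val_inj.
rewrite /invmx unitmxE A1 unitr1 invr1 scale1r mxE /cofactor det_mx11.
by rewrite !mxE l0 /= expr2 mulrNN !mul1r.
Qed.

(** The sum c x^i / t^j + d t^l, with x the coordinate 0 and t = k + the
    coordinate 1.  This family contains the potential and all entries of its
    metric, and is closed under partial derivatives. *)
Definition laurent_sum (R : realType) (k c : R) (i j : nat) (d : R) (l : nat)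
    (x : 'rV[R]_2) : R :=
  c * x 0 0 ^+ i * (k + x 0 1)^-1 ^+ j + d * (k + x 0 1) ^+ l.

Definition right_half (R : realType) (k : R) : set 'rV[R]_2 :=
  [set x | 0 < k + x 0 1].

Lemma open_right_half (R : realType) (k : R) : open (right_half k).
Proof.
rewrite (_ : right_half k =
    (fun x : 'rV[R]_2 => x 0 1) @^-1` [set t | - k < t]).
  by apply: open_comp => [x _|]; [exact: coord_continuous | exact: open_gt].
by apply/seteqP; split => x /=; rewrite /right_half/= -ltrBlDl sub0r.
Qed.

Lemma is_derive_laurent_sum (R : realType) (k c : R) (i j : nat) (d : R)
    (l : nat) (x v : 'rV[R]_2) : right_half k x ->
  is_derive x v (laurent_sum k c i j d l)
    (v 0 0 * laurent_sum k (c * i%:R) i.-1 j 0 0 x +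
     v 0 1 * laurent_sum k (- (c * j%:R)) i j.+1 (d * l%:R) l.-1 x).
Proof.
rewrite /right_half /= => t_gt0.
pose X (y : 'rV[R]_2) := y 0 0; pose T (y : 'rV[R]_2) := k + y 0 1.
have dX : is_derive x v X (v 0 0) by exact: is_derive_coord.
have dT : is_derive x v T (v 0 1).
  rewrite -[v 0 1]add0r.
  exact: is_deriveD (is_derive_cst k x v) (is_derive_coord x v 1).
have Tx : T x != 0 by rewrite gt_eqF.
have dV : is_derive x v (fun y => (T y)^-1) (- (T x) ^- 2 *: v 0 1).
  apply: DeriveDef; first by apply: derivableV => //; case: dT.
  by rewrite deriveV// derive_val.
have -> : laurent_sum k c i j d l =
    c \*: (X ^+ i * (fun y => (T y)^-1) ^+ j) + d \*: T ^+ l.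
  by apply/funext => y; rewrite /laurent_sum -mulrA !fctE.
apply: is_derive_eq; rewrite !fctE /laurent_sum -/(X x) -/(T x) -exprVn.
rewrite /GRing.scale/= !mul0r !addr0; case: j => [|j]; rewrite !exprS/=; ring.
Qed.

Lemma half_partial0_laurent_sum (R : realType) (k c : R) (i j : nat) (d : R)
    (l : nat) (F : 'rV[R]_2 -> R) :
  (forall x, right_half k x -> F x = laurent_sum k c i j d l x) ->
  forall x, right_half k x ->
    half_partial 0 F x = laurent_sum k (c * i%:R / 2) i.-1 j 0 0 x.
Proof.
move=> FE x kx; apply: (half_partial_open (open_right_half (k := k)) kx FE).
apply: is_derive_eq; first exact: is_derive_laurent_sum.
by rewrite !mxE/= mul1r mul0r addr0 /laurent_sum; field.
Qed.

Lemma half_partial1_laurent_sum (R : realType) (k c : R) (i j : nat) (d : R)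
    (l : nat) (F : 'rV[R]_2 -> R) :
  (forall x, right_half k x -> F x = laurent_sum k c i j d l x) ->
  forall x, right_half k x -> half_partial 1 F x =
    laurent_sum k (- (c * j%:R) / 2) i j.+1 (d * l%:R / 2) l.-1 x.
Proof.
move=> FE x kx; apply: (half_partial_open (open_right_half (k := k)) kx FE).
apply: is_derive_eq; first exact: is_derive_laurent_sum.
by rewrite !mxE/= mul1r mul0r add0r /laurent_sum; field.
Qed.

(** The solution u_k, as a function of the real parts. *)
Definition potential (R : realType) (k : R) : 'rV[R]_2 -> R :=
  laurent_sum k 1 2 1 (4 / 3) 3.

Definition metric_entry (R : realType) (k : R) (a b : 'I_2) : 'rV[R]_2 -> R :=
  half_partial a (half_partial b (potential k)).

Lemma metric_entryE (R : realType) (k : R) (x : 'rV[R]_2) : right_half k x ->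
  let t := k + x 0 1 in
  [/\ metric_entry k 0 0 x = (2 * t)^-1,
      metric_entry k 0 1 x = - x 0 0 / (2 * t ^+ 2),
      metric_entry k 1 0 x = - x 0 0 / (2 * t ^+ 2)
    & metric_entry k 1 1 x = x 0 0 ^+ 2 / (2 * t ^+ 3) + 2 * t].
Proof.
move=> kx t; have t0 : t != 0 by rewrite gt_eqF.
have D0 := half_partial0_laurent_sum (fun y _ => erefl (potential k y)).
have D1 := half_partial1_laurent_sum (fun y _ => erefl (potential k y)).
split; rewrite /metric_entry.
- by rewrite (half_partial0_laurent_sum D0 kx) /laurent_sum /= -/t; field.
- by rewrite (half_partial0_laurent_sum D1 kx) /laurent_sum /= -/t; field.
- by rewrite (half_partial1_laurent_sum D0 kx) /laurent_sum /= -/t; field.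
- by rewrite (half_partial1_laurent_sum D1 kx) /laurent_sum /= -/t; field.
Qed.

Lemma det_hessian_potential (R : realType) (k : R) (p : 'rV[R[i]]_2) :
  right_half k (re_part p) ->
  \det (complex_hessian (potential k \o @re_part R 2) p) = 1.
Proof.
move=> kp; rewrite complex_hessian_tube det2E !mxE /tube.
have [g00 g01 g10 g11] := metric_entryE kp.
rewrite -/(metric_entry k 0 0) -/(metric_entry k 0 1) -/(metric_entry k 1 0).
rewrite -/(metric_entry k 1 1) g00 g01 g10 g11.
set t := k + _; set a := re_part p 0 0.
transitivity (((2 * t)^-1 * (a ^+ 2 / (2 * t ^+ 3) + 2 * t)
    - - a / (2 * t ^+ 2) * (- a / (2 * t ^+ 2)))%:C).
  by rewrite rmorphB !rmorphM.
rewrite [X in X%:C](_ : _ = 1)//; field.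
by rewrite gt_eqF.
Qed.

Lemma metric_entry_derivatives (R : realType) (k : R) (x : 'rV[R]_2) :
  right_half k x ->
  let t := k + x 0 1 in
  [/\ half_partial 0 (metric_entry k 0 0) x = 0,
      half_partial 0 (half_partial 0 (metric_entry k 0 0)) x = 0,
      half_partial 0 (metric_entry k 0 1) x = - (4 * t ^+ 2)^-1
    & half_partial 0 (metric_entry k 1 0) x = - (4 * t ^+ 2)^-1].
Proof.
move=> kx t; have t0 : t != 0 by rewrite gt_eqF.
have D0 := half_partial0_laurent_sum (fun y _ => erefl (potential k y)).
have D1 := half_partial1_laurent_sum (fun y _ => erefl (potential k y)).
have D000 := half_partial0_laurent_sum (half_partial0_laurent_sum D0).
split; rewrite /metric_entry.
- by rewrite (D000 _ kx) /laurent_sum /= -/t; field.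
- by rewrite (half_partial0_laurent_sum D000 kx) /laurent_sum /= -/t; field.
- rewrite (half_partial0_laurent_sum (half_partial0_laurent_sum D1) kx).
  by rewrite /laurent_sum /= -/t; field.
- rewrite (half_partial0_laurent_sum (half_partial1_laurent_sum D0) kx).
  by rewrite /laurent_sum /= -/t; field.
Qed.

(** Since g_00 depends on t only, the second derivative of g_00 along z vanishes
    and so do the terms of the sum with l = 0 or m = 0; what remains is
    g^11 (d_0 g_01) (d_0bar g_10), with g^11 = g_00 because det g = 1. *)
Lemma curvature_potential (R : realType) (k : R) (p : 'rV[R[i]]_2) :
  right_half k (re_part p) ->
  kahler_curvature (complex_hessian (potential k \o @re_part R 2)) p 0 0 0 0 =
  ((32 * (k + re_part p 0 1) ^+ 5)^-1)%:C.
Proof.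
move=> kp.
have [g00 _ _ _] := metric_entryE kp.
have [d00 d000 d01 d10] := metric_entry_derivatives kp.
have inv11 := invmx2_11 (det_hessian_potential kp).
move: inv11; set H := complex_hessian _.
have entryE a b : (fun q => H q a b) = tube (metric_entry k a b).
  by apply/funext => q; rewrite /H complex_hessian_tube mxE.
have H00 : H p 0 0 = (metric_entry k 0 0 (re_part p))%:C.
  by rewrite -[LHS]/((fun q => H q 0 0) p) entryE.
(* Opaque heads keep failed matches from unfolding the derivatives. *)
clearbody H; rewrite {}H00 g00 => inv11.
have ddE : dz 0 (dzbar 0 (fun q => H q 0 0)) p = 0.
  by rewrite entryE dzbar_tube dz_tube /tube d000.
pose dg a b := half_partial 0 (metric_entry k a b) (re_part p).
have dzE a b : dz 0 (fun q => H q a b) p = (dg a b)%:C.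
  by rewrite entryE dz_tube.
have dzbarE a b : dzbar 0 (fun q => H q a b) p = (dg a b)%:C.
  by rewrite entryE dzbar_tube.
have dg00 : dg 0 0 = 0 := d00.
have dg01 : dg 0 1 = - (4 * (k + re_part p 0 1) ^+ 2)^-1 := d01.
have dg10 : dg 1 0 = - (4 * (k + re_part p 0 1) ^+ 2)^-1 := d10.
clearbody dg; clear d00 d01 d10 d000.
rewrite /kahler_curvature ddE !big2E /= !dzE !dzbarE.
rewrite dg00 dg01 dg10 inv11.
rewrite oppr0 !(mulr0, mul0r, addr0, add0r).
set t := k + _; have t0 : t != 0 by rewrite gt_eqF.
rewrite -(rmorphM (real_complex R)) -(rmorphM (real_complex R)).
congr (_%:C); field.
exact: t0.
Qed.

(** * Real-analyticity *)

(** The 2 n real coordinates are the real parts followed by the imaginary parts;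
    the latter carry the constant factor 1. *)
Lemma real_analytic_on_prod_re (R : realType) (n : nat)
    (Om : set 'rV[R[i]]_n) (f : 'I_n -> R -> R) :
  (forall p, Om p -> forall j, analytic1_at (f j) (re_part p 0 j)) ->
  real_analytic_on Om (fun p => \prod_j f j (re_part p 0 j)).
Proof.
move=> fan x Omx.
pose f' (j : 'I_(n + n)) : R -> R :=
  match fintype.split j with inl i => f i | inr _ => horner 1 end.
have f'l i : f' (lshift n i) = f i by rewrite /f' (unsplitK (inl _ i)).
have f'r i : f' (rshift n i) = horner 1 by rewrite /f' (unsplitK (inr _ i)).
have -> : (fun p => \prod_j f j (re_part p 0 j)) \o @complex_of_coords R n =
    (fun y => \prod_j f' j (y 0 j)).
  apply/funext => y; rewrite big_split_ord /= [X in _ * X]big1 => [|i _].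
    by rewrite mulr1; apply: eq_bigr => i _; rewrite f'l !mxE.
  by rewrite f'r hornerE.
apply: real_analytic_at_prod => j; rewrite -[j]splitK.
case: (fintype.split j) => i /=; last by rewrite f'r; exact: analytic1_poly.
by rewrite f'l; have := fan _ Omx i; rewrite !mxE.
Qed.

Lemma real_analytic_on_potential (R : realType) (k : R) (Om : set 'rV[R[i]]_2) :
  Om `<=` [set p | right_half k (re_part p)] ->
  real_analytic_on Om (potential k \o @re_part R 2).
Proof.
move=> Omk.
pose f (j : 'I_2) : R -> R :=
  if j == 0 then horner 'X^2 else fun t => (k + t)^-1.
pose g (j : 'I_2) : R -> R :=
  if j == 0 then horner 1 else fun t => ((4 / 3) *: 'X^3).[k + t].
have -> : potential k \o @re_part R 2 = (fun p =>
    \prod_j f j (re_part p 0 j) + \prod_j g j (re_part p 0 j)).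
  apply/funext => p; rewrite !big2E /f /g /= !hornerE.
  by rewrite /potential /laurent_sum /=; ring.
move=> x Omx; apply: real_analytic_atD.
  apply: (real_analytic_on_prod_re (Om := Om)) Omx => p /Omk kp j; rewrite /f.
  case: eqP => [_|/eqP j0]; first exact: analytic1_poly.
  have -> : j = 1 by apply: val_inj; case: j j0 => [[|[|]]].
  by apply: analytic1_shift; apply: analytic1_inv; rewrite gt_eqF.
apply: (real_analytic_on_prod_re (Om := Om)) Omx => p _ j; rewrite /g.
case: eqP => _; first exact: analytic1_poly.
by apply: analytic1_shift; exact: analytic1_poly.
Qed.

(** * Plurisubharmonicity *)

Lemma continuous_circle_affine (R : realType) (c a b : R) :
  continuous (fun t : R => c + a * cos t - b * sin t).
Proof.
move=> t; apply: cvgB.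
  apply: cvgD; [exact: cvg_cst|apply: cvgM; first exact: cvg_cst].
  exact: continuous_cos.
by apply: cvgM; [exact: cvg_cst | exact: continuous_sin].
Qed.

Lemma integral_circle_affine (R : realType) (c a b : R) :
  (\int[lebesgue_measure]_(t in `[0%R, (2 * pi)%R])
    (c + a * cos t - b * sin t)%:E = (2 * pi * c)%:E)%E.
Proof.
pose G : R -> R := c \*: id + a \*: sin + b \*: cos.
have dG (t : R) : is_derive t (1 : R) G (c + a * cos t - b * sin t).
  apply: is_derive_eq; rewrite /GRing.scale/=; ring.
have cG : continuous G.
  by move=> t; apply/differentiable_continuous/derivable1_diffP; case: (dG t).
rewrite (@continuous_FTC2 _ _ G).
- have GE t : G t = c * t + a * sin t + b * cos t by [].
  rewrite -EFinB !GE mulr_natl sin0 cos0 sin2pi cos2pi.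
  by congr EFin; ring.
- by rewrite mulr_gt0// pi_gt0.
- exact/continuous_subspaceT/continuous_circle_affine.
- split.
  + by move=> t _; case: (dG t).
  + exact/cvg_at_right_filter/cG.
  + exact/cvg_at_left_filter/cG.
- by move=> t _; rewrite derive1E; exact: derive_val.
Qed.

Definition im_part (R : realType) (n : nat) (p : 'rV[R[i]]_n) : 'rV[R]_n :=
  map_mx (@complex.Im R) p.

Lemma re_part_circle (R : realType) (n : nat) (p v : 'rV[R[i]]_n) (t : R) :
  re_part (p + (cos t +i* sin t)%C *: v) =
  re_part p + (cos t *: re_part v - sin t *: im_part v).
Proof.
by apply/rowP => j; rewrite !mxE; case: (p 0 j) (v 0 j) => a b [c d].
Qed.

(** On a circle with centre p, the affine function that supports F at the real
    part of p is its value at the centre plus a combination of cos and sin, and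
    these have mean 0; integrating the support inequality gives the sub-mean
    value inequality. *)
Lemma plurisubharmonic_tube (R : realType) (n : nat) (Om : set 'rV[R[i]]_n)
    (F : 'rV[R]_n -> R) :
  (forall p, Om p -> {for re_part p, continuous F}) ->
  (forall p, Om p -> exists l : 'rV[R]_n, forall q, Om q ->
    F (re_part p) + \sum_j l 0 j * (re_part q - re_part p) 0 j
      <= F (re_part q)) ->
  plurisubharmonic_on Om (F \o @re_part R n).
Proof.
move=> cF supp; split => [p Omp a Fa | p v Omv].
  have /nbhs_ballP[e /= e0 Fe] : \forall y \near re_part p, F y < a.
    exact: (cvgr_lt _ (cF p Omp)).
  exists e; split => // q Omq pq; apply: Fe; split=> [//|i j].
  rewrite ord1 !mxE.
  rewrite /ball /= distrC -ltcR; apply: le_lt_trans (pq j).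
  apply: le_trans (normc_ge_Re _).
  by case: (q 0 j) (p 0 j) => b c [b' c'].
pose gam t := re_part (p + (cos t +i* sin t)%C *: v).
have Omgam t : Om (p + (cos t +i* sin t)%C *: v).
  by apply: Omv; rewrite normc_def /= cos2Dsin2 sqrtr1.
have Omp : Om p by have := Omv 0; rewrite normr0 scale0r addr0; apply.
have [l supp_l] := supp p Omp.
pose A := \sum_j l 0 j * re_part v 0 j; pose B := \sum_j l 0 j * im_part v 0 j.
have cgam : continuous gam.
  rewrite (_ : gam = fun t =>
      re_part p + (cos t *: re_part v - sin t *: im_part v)); last first.
    by apply/funext => t; exact: re_part_circle.
  move=> t; apply: cvgD; first exact: cvg_cst.
  apply: cvgB; apply: cvgZr_tmp.
    exact: continuous_cos.
  exact: continuous_sin.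
have pi2_gt0 : 0 < 2 * pi :> R by rewrite mulr_gt0// pi_gt0.
rewrite lee_pdivlMl// -EFinM -(integral_circle_affine (F (re_part p)) A B).
apply: le_integral => //.
- apply: continuous_compact_integrable; first exact: segment_compact.
  exact/continuous_subspaceT/continuous_circle_affine.
- apply: continuous_compact_integrable; first exact: segment_compact.
  apply: continuous_subspaceT => t.
  by apply: (continuous_comp (cgam t)); exact: cF.
- move=> t _; rewrite lee_fin; apply: le_trans (supp_l _ (Omgam t)).
  rewrite -addrA lerD2l /A /B !mulr_suml -sumrB ler_sum// => j _.
  rewrite re_part_circle (addrC (re_part p)) addrK !mxE.
  by rewrite le_eqVlt; apply/orP; left; apply/eqP; ring.
Qed.

(** * The solutions on the cylinder *)

Lemma continuous_potential (R : realType) (k : R) (x : 'rV[R]_2) :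
  right_half k x -> {for x, continuous (potential k)}.
Proof.
move=> kx.
(* Stated for an arbitrary filter: the neighbourhoods of a matrix unfold to
   those of its entries, which hides their filter instance. *)
have lim_along (G : set_system 'rV[R]_2) : Filter G ->
    (forall j, (fun y : 'rV[R]_2 => y 0 j) @ G --> x 0 j) ->
    potential k @ G --> potential k x.
  move=> FG cX.
  have cT : (fun y : 'rV[R]_2 => k + y 0 1) @ G --> k + x 0 1.
    by apply: cvgD; [exact: cvg_cst | exact: cX].
  have cV : (fun y : 'rV[R]_2 => (k + y 0 1)^-1) @ G --> (k + x 0 1)^-1.
    exact: cvgV (lt0r_neq0 kx) cT.
  have cXn (f : 'rV[R]_2 -> R) (a : R) n :
      f @ G --> a -> (fun y => f y ^+ n) @ G --> a ^+ n.
    by move=> fa; exact: continuous_cvg (@exprn_continuous _ n a) fa.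
  have cC (c : R) : (fun _ : 'rV[R]_2 => c) @ G --> c by exact: cvg_cst.
  exact: cvgD (cvgM (cvgM (cC 1) (cXn _ _ 2 (cX 0))) (cXn _ _ 1 cV))
    (cvgM (cC (4 / 3)) (cXn _ _ 3 cT)).
apply: (lim_along (nbhs x)) => j; exact: coord_continuous.
Qed.

(** Convexity, through the gradient l of the potential at x.  With s, t the
    values of k + the coordinate 1 at x and y, the gap between the two sides is
      (y_0 - (x_0 / s) t)^2 / t + (4 / 3) (t - s)^2 (t + 2 s) >= 0. *)
Lemma potential_support (R : realType) (k : R) (x : 'rV[R]_2) :
  right_half k x -> exists l : 'rV[R]_2, forall y, right_half k y ->
    potential k x + \sum_j l 0 j * (y - x) 0 j <= potential k y.
Proof.
rewrite /right_half /= => kx; set s := k + x 0 1 in kx.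
pose l (j : 'I_2) : R :=
  if j == 0 then 2 * x 0 0 / s else 4 * s ^+ 2 - (x 0 0 / s) ^+ 2.
exists (\row_j l j) => y ky; set t := k + y 0 1 in ky.
rewrite big2E !mxE /l /= -subr_ge0 /potential /laurent_sum -/s -/t.
have -> : y 0 1 - x 0 1 = t - s by rewrite /s /t; ring.
rewrite [leRHS](_ : _ = (y 0 0 - x 0 0 / s * t) ^+ 2 / t
    + 4 / 3 * ((t - s) ^+ 2 * (t + 2 * s))); last first.
  by field; rewrite !gt_eqF.
have [s0 t0] := (ltW kx, ltW ky).
apply: addr_ge0; first by rewrite divr_ge0 ?sqr_ge0.
apply: mulr_ge0; first by rewrite divr_ge0.
by apply: mulr_ge0; [exact: sqr_ge0 | rewrite addr_ge0 ?mulr_ge0].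
Qed.

Lemma cylinder_right_half (R : realType) (r k : R) : r <= k ->
  cylinder r `<=` [set p | right_half k (re_part p)].
Proof.
move=> rk p; rewrite /cylinder /right_half /= mxE => pr.
have {pr} : `|complex.Re (p 0 1)| < r.
  by rewrite -ltcR; apply: le_lt_trans pr; exact: normc_ge_Re.
by rewrite ltr_norml => /andP[+ _]; lra.
Qed.

Unset Implicit Arguments.

(* Functions are total on C^2; the restriction _ \_ (cylinder r), equal to 0
   off the cylinder, makes the solutions be counted as functions on it. *)
Theorem theorem3p1 (R : realType) (r : R) (r_gt0 : 0 < r) :
  infinite_set
    [set u \_ (cylinder r) | u in
      [set u : 'rV[R[i]]_2 -> R |
        [/\ real_analytic_on (cylinder r) u,
            plurisubharmonic_on (cylinder r) u,
            forall p, cylinder r p -> \det (complex_hessian u p) = 1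
          & nowhere_flat_on (cylinder r) (complex_hessian u)]]].
Proof.
pose k (n : nat) := r + n%:R.
pose u n := potential (k n) \o @re_part R 2.
have half n : cylinder r `<=` [set p | right_half (k n) (re_part p)].
  by apply: cylinder_right_half; rewrite lerDl.
move=> /(finite_preimage (f := fun n => u n \_ (cylinder r))) fin.
apply: infinite_nat; apply: sub_finite_set (fin _) => [n _ | m n _ _].
  exists (u n) => //; split.
  - exact: real_analytic_on_potential (half n).
  - apply: plurisubharmonic_tube => p /(half n) hp.
      exact: continuous_potential hp.
    have [l sl] := potential_support hp.
    by exists l => q /(half n); exact: sl.
  - by move=> p /(half n); exact: det_hessian_potential.
  - move=> p /(half n) hp; exists 0, 0, 0, 0; rewrite curvature_potential//.
    rewrite fmorph_eq0 invr_eq0 mulf_neq0 ?pnatr_eq0//.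
    by rewrite expf_neq0// gt_eqF.
have cyl0 : cylinder r (0 : 'rV[R[i]]_2).
  by rewrite /cylinder /= mxE normr0 ltcR.
move=> /(congr1 (fun f => f 0)); rewrite !patchE !mem_set//.
rewrite /u /potential /laurent_sum /= !mxE /= !addr0 expr0n.
rewrite /= mulr0 !mul0r !add0r.
have k0 i : 0 <= k i by rewrite addr_ge0// ltW.
have c0 : 4 / 3 != 0 :> R by rewrite mulf_neq0 ?invr_eq0 ?pnatr_eq0.
move=> /(mulfI c0)/(pexpIrn (isT : (0 < 3)%N) (k0 m) (k0 n))/addrI/eqP.
by rewrite eqr_nat => /eqP.
Qed.
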